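(* Let $(M,T^{1,0}M,\theta)$ be a three-dimensional strongly pseudoconvex pseudohermitian CR manifold (with positive definite Levi form), and let $f\colon M\to\mathbb{R}^n$ be an isometric immersion with respect to the Webster metric $g_\theta$. Consider the conditions: (1) $f$ is CR pluriharmonic; (2) $\langle\Delta_{GL}f,\Delta_{GL}f\rangle=0$; (3) $\Delta_Rf$ is orthogonal to $TM$ (i.e. to $f_*TM$) and has constant length. Then $(1)\Longrightarrow(2)\Longrightarrow(3)$.
   Context: All objects are smooth. A three-dimensional CR manifold (of hypersurface type) is a real 3-manifold $M$ with a complex line subbundle $T^{1,0}M\subset T^{\mathbb{C}}M=\mathbb{C}\otimes TM$ such that $T^{1,0}M\cap\overline{T^{1,0}M}=0$ (and $[\Gamma(T^{1,0}M),\Gamma(T^{1,0}M)]\subset\Gamma(T^{1,0}M)$, automatic here); $T^{0,1}M=\overline{T^{1,0}M}$. A CR function is a smooth $h\colon M\to\mathbb{C}$ with $\bar Zh=0$ for all $Z\in T^{1,0}M$; a real function is CR pluriharmonic if it is locally the real part of a CR function, and an $\mathbb{R}^n$-valued map is CR pluriharmonic if all its components are. A pseudohermitian structure is a nowhere vanishing real 1-form $\theta$ with $\ker\theta=T^{1,0}M\oplus T^{0,1}M$. Levi form: $\mathcal{L}_\theta(Z,W)=\mathrm{i}\,\mathrm{d}\theta(Z,\bar W)$ for $Z,W\in T^{1,0}M$, with $\mathrm{d}\theta(X,Y)=X\theta(Y)-Y\theta(X)-\theta([X,Y])$. $M$ is strongly pseudoconvex if $\mathcal{L}_\theta$ is definite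 at each point; the sign of $\theta$ is chosen so that $\mathcal{L}_\theta$ is positive definite. The Reeb field $T$ is defined by $\theta(T)=1$, $i_T\mathrm{d}\theta=0$. The Webster metric $g_\theta$ is the Riemannian metric with $g_\theta(X,Y)=\Re\mathcal{L}_\theta(Z,W)$ for $X=(Z+\bar Z)/\sqrt2$, $Y=(W+\bar W)/\sqrt2$, $Z,W\in T^{1,0}M$, and $g_\theta(X,T)=0$, $g_\theta(T,T)=1$. Isometric means that the pullback of the Euclidean metric is $g_\theta$. A pseudohermitian local frame is a local frame $(Z,\bar Z,T)$ with $Z\in T^{1,0}M$, $\mathcal{L}_\theta(Z,Z)=1$ and $T$ the Reeb field; $(\zeta,\bar\zeta,\theta)$ is its dual coframe, and $a=\mathrm{i}\,\zeta([Z,\bar Z])$. On functions, the Garfield--Lee Laplacian and the Rumin Laplacian are given (independently of the choice of frame) by $$\Delta_{GL}f=-(Z\bar Z+\mathrm{i}\bar a\bar Z)f,\qquad \Delta_Rf=-Z\bar Zf-\mathrm{i}\bar a\bar Zf-\bar ZZf+\mathrm{i}aZf,$$ and they act componentwise on vector-valued functions. $\langle\cdot,\cdot\rangle$ is the standard bilinear symmetric product on $\mathbb{C}^n$. *)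

(* Defs.v *)
From HB Require Import structures.
From mathcomp Require Import all_boot all_order all_algebra.
From mathcomp Require Import all_classical all_reals all_analysis.
From mathcomp.real_closed Require Import complex.
Set Implicit Arguments.
Unset Strict Implicit.
Unset Printing Implicit Defensive.
Import Order.TTheory GRing.Theory Num.Theory.
Import numFieldNormedType.Exports.
Local Open Scope classical_set_scope.
Local Open Scope ring_scope.
Local Open Scope complex_scope.

Fixpoint Ck_on (R : realType) (k : nat) (U : set 'rV[R]_3) (f : 'rV[R]_3 -> R)
    : Prop :=
  (forall x, U x -> {for x, continuous f}) /\
  match k with
  | 0%N => True
  | k'.+1 => forall i : 'I_3,
      (forall x, U x -> derivable f x (delta_mx 0 i)) /\
      Ck_on k' U (fun x => 'D_(delta_mx 0 i) f x)
  end.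

Definition Cinfty_on (R : realType) (U : set 'rV[R]_3) (f : 'rV[R]_3 -> R) :
  Prop := forall k, Ck_on k U f.

Record chart (R : realType) (M : topologicalType) := Chart {
  chart_dom : set M;
  chart_map :> M -> 'rV[R]_3;
  chart_inv : 'rV[R]_3 -> M;
  chart_dom_open : open chart_dom;
  chart_img_open : open (chart_map @` chart_dom);
  chart_invK : forall p, chart_dom p -> chart_inv (chart_map p) = p;
  chart_continuous : forall p, chart_dom p -> {for p, continuous chart_map};
  chart_inv_continuous : forall x, (chart_map @` chart_dom) x ->
    {for x, continuous chart_inv} }.

Record manifold3 (R : realType) := Manifold3 {
  mspace :> topologicalType;
  m_hausdorff : hausdorff_space mspace;
  m_second_countable : @second_countable mspace;
  atlas : set (chart R mspace);
  atlas_cover : forall p, exists2 c, atlas c & chart_dom c p;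
  atlas_compat : forall c c', atlas c -> atlas c' -> forall j : 'I_3,
    Cinfty_on (c @` (chart_dom c `&` chart_dom c'))
      (fun x => c' (chart_inv c x) 0 j) }.

(* Functions on an open set U are represented by total functions on M whose
   values outside of U are irrelevant; the same holds for vector fields and
   forms below. *)
Definition rsmooth (R : realType) (M : manifold3 R) (U : set M)
    (f : M -> R) : Prop :=
  forall c : chart R M, atlas c ->
    Cinfty_on (c @` (chart_dom c `&` U)) (fun x => f (chart_inv c x)).

Definition csmooth (R : realType) (M : manifold3 R) (U : set M)
    (f : M -> R[i]) : Prop :=
  rsmooth U (fun p => complex.Re (f p)) /\
  rsmooth U (fun p => complex.Im (f p)).

Definition csmooth_at (R : realType) (M : manifold3 R) (p : M)
    (f : M -> R[i]) : Prop :=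
  exists U : set M, [/\ open U, U p & csmooth U f].

(* The complexified tangent space at p is the space of C-linear derivations of
   the algebra of germs at p of complex-valued smooth functions.  A derivation
   is extended by 0 to the functions that are not smooth near p, so that two
   derivations are equal as soon as they agree on germs. *)
Definition tvec (R : realType) (M : manifold3 R) : Type := (M -> R[i]) -> R[i].

Definition ctangent (R : realType) (M : manifold3 R) (p : M) (v : tvec M) :
    Prop :=
  [/\ forall f, ~ csmooth_at p f -> v f = 0,
      forall f g, csmooth_at p f -> csmooth_at p g ->
        (\forall q \near p, f q = g q) -> v f = v g,
      forall (c : R[i]) f g, csmooth_at p f -> csmooth_at p g ->
        v (fun q => c * f q + g q) = c * v f + v g &
      forall f g, csmooth_at p f -> csmooth_at p g ->
        v (fun q => f q * g q) = v f * g p + f p * v g].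

Definition tzero (R : realType) (M : manifold3 R) : tvec M := fun _ => 0.

Definition tlin (R : realType) (M : manifold3 R) (c : R[i]) (v w : tvec M) :
  tvec M := fun f => c * v f + w f.

Definition tconj (R : realType) (M : manifold3 R) (v : tvec M) : tvec M :=
  fun f => (v (fun q => (f q)^*))^*.

(* The real tangent space is the fixed space of the conjugation. *)
Definition real_tangent (R : realType) (M : manifold3 R) (p : M)
  (v : tvec M) : Prop := ctangent p v /\ tconj v = v.

(* The function X f is fun p => X p f. *)
Definition vfield (R : realType) (M : manifold3 R) : Type := M -> tvec M.

Definition smooth_vfield (R : realType) (M : manifold3 R) (U : set M)
    (X : vfield M) : Prop :=
  (forall p, U p -> ctangent p (X p)) /\
  (forall (V : set M) f, open V -> V `<=` U -> csmooth V f ->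
    csmooth V (fun p => X p f)).

Definition fconj (R : realType) (M : manifold3 R) (X : vfield M) : vfield M :=
  fun p => tconj (X p).

Definition bracket (R : realType) (M : manifold3 R) (X Y : vfield M) :
    vfield M :=
  fun p f => if `[< csmooth_at p f >]
    then X p (fun q => Y q f) - Y p (fun q => X q f) else 0.

Definition form1 (R : realType) (M : manifold3 R) : Type := M -> tvec M -> R[i].

Definition smooth_form (R : realType) (M : manifold3 R) (U : set M)
    (om : form1 M) : Prop :=
  (forall p, U p -> forall c v w, ctangent p v -> ctangent p w ->
    om p (tlin c v w) = c * om p v + om p w) /\
  (forall (V : set M) X, open V -> V `<=` U -> smooth_vfield V X ->
    csmooth V (fun p => om p (X p))).

Definition dform (R : realType) (M : manifold3 R) (om : form1 M)
    (X Y : vfield M) (p : M) : R[i] :=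
  X p (fun q => om q (Y q)) - Y p (fun q => om q (X q))
  - om p (bracket X Y p).

Definition section_of (R : realType) (M : manifold3 R) (E : M -> set (tvec M))
    (U : set M) (Z : vfield M) : Prop :=
  smooth_vfield U Z /\ forall p, U p -> E p (Z p).

Definition conj_bundle (R : realType) (M : manifold3 R)
  (E : M -> set (tvec M)) (p : M) : set (tvec M) := @tconj R M @` E p.

Definition line_subbundle (R : realType) (M : manifold3 R)
    (E : M -> set (tvec M)) : Prop :=
  forall p : M, exists U Z, [/\ open U, U p, smooth_vfield U Z &
    forall q, U q -> Z q <> @tzero R M /\
      E q = [set v | exists c : R[i], v = tlin c (Z q) (@tzero R M)]].

Record CR_structure (R : realType) (M : manifold3 R) := CRStructure {
  T10 : M -> set (tvec M);
  T10_line_subbundle : line_subbundle T10;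
  T10_conj_disjoint :
    forall p, T10 p `&` conj_bundle T10 p = [set @tzero R M];
  T10_integrable : forall (U : set M) Z W, open U ->
    section_of T10 U Z -> section_of T10 U W ->
    forall p, U p -> T10 p (bracket Z W p) }.

Definition CR_function (R : realType) (M : manifold3 R) (H : CR_structure M)
    (U : set M) (h : M -> R[i]) : Prop :=
  csmooth U h /\ forall p v, U p -> T10 H p v -> tconj v h = 0.

Definition CR_pluriharmonic (R : realType) (M : manifold3 R)
    (H : CR_structure M) (u : M -> R) : Prop :=
  forall p : M, exists U h, [/\ open U, U p, CR_function H U h &
    forall q, U q -> u q = complex.Re (h q)].

Definition pseudohermitian (R : realType) (M : manifold3 R)
    (H : CR_structure M) (theta : form1 M) : Prop :=
  [/\ smooth_form setT theta,
      forall p v, ctangent p v -> theta p (tconj v) = (theta p v)^*,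
      forall p, exists2 v, ctangent p v & theta p v <> 0 &
      forall p v, ctangent p v -> (theta p v = 0 <->
        exists z w, [/\ T10 H p z, conj_bundle (T10 H) p w &
          v = tlin 1 z w])].

Definition levi (R : realType) (M : manifold3 R) (theta : form1 M)
    (Z W : vfield M) (p : M) : R[i] :=
  'i%C * dform theta Z (fconj W) p.

(* In R[i], 0 < z means that z is real and positive. *)
Definition levi_pos_def (R : realType) (M : manifold3 R)
    (H : CR_structure M) (theta : form1 M) : Prop :=
  forall (U : set M) Z, open U -> section_of (T10 H) U Z ->
    forall p, U p -> Z p <> @tzero R M -> 0 < levi theta Z Z p.

Definition reeb_field (R : realType) (M : manifold3 R) (theta : form1 M)
    (T : vfield M) : Prop :=
  [/\ smooth_vfield setT T,
      forall p, tconj (T p) = T p,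
      forall p, theta p (T p) = 1 &
      forall (U : set M) X, open U -> smooth_vfield U X ->
        forall p, U p -> dform theta T X p = 0].

(* Only the values on real tangent vectors matter. *)
Definition metric_tensor (R : realType) (M : manifold3 R) : Type :=
  M -> tvec M -> tvec M -> R.

Definition riemannian (R : realType) (M : manifold3 R) (g : metric_tensor M) :
    Prop :=
  [/\ forall p (c : R) u v w,
        real_tangent p u -> real_tangent p v -> real_tangent p w ->
        g p (tlin c%:C u v) w = c * g p u w + g p v w,
      forall p v w, real_tangent p v -> real_tangent p w ->
        g p v w = g p w v,
      forall p v, real_tangent p v -> v <> @tzero R M -> 0 < g p v v &
      forall (U : set M) X Y, open U ->
        smooth_vfield U X -> smooth_vfield U Y ->
        (forall p, U p -> tconj (X p) = X p) ->
        (forall p, U p -> tconj (Y p) = Y p) ->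
        rsmooth U (fun p => g p (X p) (Y p))].

(* (Z + conj Z) / sqrt 2 *)
Definition real_part (R : realType) (M : manifold3 R) (z : tvec M) : tvec M :=
  fun f => (z f + tconj z f) / (Num.sqrt (2 : R))%:C.

Definition webster_metric (R : realType) (M : manifold3 R)
    (H : CR_structure M) (theta : form1 M) (T : vfield M)
    (g : metric_tensor M) :
    Prop :=
  [/\ riemannian g,
      forall (U : set M) Z W, open U ->
        section_of (T10 H) U Z -> section_of (T10 H) U W ->
        forall p, U p -> g p (real_part (Z p)) (real_part (W p))
                         = complex.Re (levi theta Z W p),
      forall p z, T10 H p z -> g p (real_part z) (T p) = 0 &
      forall p, g p (T p) (T p) = 1].

(* (Z, conj Z, T) is a local frame on U with dual coframe
   (zeta, conj zeta, theta), where conj zeta is v |-> (zeta (tconj v))^*.  The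
   duality relations not listed follow by conjugation, or from the definitions
   of theta and T. *)
Definition pseudohermitian_frame (R : realType) (M : manifold3 R)
    (H : CR_structure M) (theta : form1 M) (T : vfield M)
    (U : set M) (Z : vfield M) (zeta : form1 M) : Prop :=
  [/\ open U,
      section_of (T10 H) U Z,
      forall p, U p -> levi theta Z Z p = 1,
      smooth_form U zeta &
      forall p, U p ->
        [/\ zeta p (Z p) = 1, zeta p (fconj Z p) = 0 & zeta p (T p) = 0]].

Definition frame_coef (R : realType) (M : manifold3 R) (Z : vfield M)
    (zeta : form1 M) (p : M) : R[i] :=
  'i%C * zeta p (bracket Z (fconj Z) p).

Definition garfield_lee (R : realType) (M : manifold3 R) (Z : vfield M)
    (zeta : form1 M) (u : M -> R[i]) (p : M) : R[i] :=
  let a := frame_coef Z zeta p in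
  - (Z p (fun q => fconj Z q u) + 'i%C * a^* * fconj Z p u).

Definition rumin (R : realType) (M : manifold3 R) (Z : vfield M)
    (zeta : form1 M) (u : M -> R[i]) (p : M) : R[i] :=
  let a := frame_coef Z zeta p in
  - Z p (fun q => fconj Z q u) - 'i%C * a^* * fconj Z p u
  - fconj Z p (fun q => Z q u) + 'i%C * a * Z p u.

Definition component (R : realType) (M : manifold3 R) (n : nat)
  (f : M -> 'rV[R]_n) (j : 'I_n) : M -> R := fun p => f p 0 j.

Definition componentC (R : realType) (M : manifold3 R) (n : nat)
  (f : M -> 'rV[R]_n) (j : 'I_n) : M -> R[i] := fun p => (f p 0 j)%:C.

Definition cvec_dot (R : realType) (n : nat) (x y : 'rV[R[i]]_n) : R[i] :=
  \sum_(j < n) x 0 j * y 0 j.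

Definition cvec_length (R : realType) (n : nat) (x : 'rV[R[i]]_n) : R :=
  Num.sqrt (\sum_(j < n) (complex.Re (x 0 j) ^+ 2 + complex.Im (x 0 j) ^+ 2)).

Definition pushforward (R : realType) (M : manifold3 R) (n : nat)
    (f : M -> 'rV[R]_n) (v : tvec M) : 'rV[R[i]]_n :=
  \row_j v (componentC f j).

Definition garfield_lee_map (R : realType) (M : manifold3 R) (n : nat)
    (Z : vfield M) (zeta : form1 M) (f : M -> 'rV[R]_n) (p : M) :
    'rV[R[i]]_n :=
  \row_j garfield_lee Z zeta (componentC f j) p.

Definition rumin_map (R : realType) (M : manifold3 R) (n : nat)
    (Z : vfield M) (zeta : form1 M) (f : M -> 'rV[R]_n) (p : M) :
    'rV[R[i]]_n :=
  \row_j rumin Z zeta (componentC f j) p.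

Definition immersion (R : realType) (M : manifold3 R) (n : nat)
    (f : M -> 'rV[R]_n) : Prop :=
  (forall j, rsmooth setT (component f j)) /\
  (forall p v, real_tangent p v -> pushforward f v = 0 -> v = @tzero R M).

Definition isometric (R : realType) (M : manifold3 R) (n : nat)
    (g : metric_tensor M) (f : M -> 'rV[R]_n) : Prop :=
  forall p v w, real_tangent p v -> real_tangent p w ->
    cvec_dot (pushforward f v) (pushforward f w) = (g p v w)%:C.

Definition pluriharmonic_map (R : realType) (M : manifold3 R)
    (H : CR_structure M) (n : nat) (f : M -> 'rV[R]_n) : Prop :=
  forall j, CR_pluriharmonic H (component f j).

(* The two Laplacians do not depend on the local frame, and every point has a
   neighbourhood carrying one; a condition on Delta f is imposed at each point
   on the expression of Delta f in every local frame around it. *)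
Definition garfield_lee_isotropic (R : realType) (M : manifold3 R)
    (H : CR_structure M) (theta : form1 M) (T : vfield M) (n : nat)
    (f : M -> 'rV[R]_n) : Prop :=
  forall U Z zeta, pseudohermitian_frame H theta T U Z zeta ->
  forall p, U p ->
    cvec_dot (garfield_lee_map Z zeta f p) (garfield_lee_map Z zeta f p) = 0.

Definition rumin_normal_constant_length (R : realType) (M : manifold3 R)
    (H : CR_structure M) (theta : form1 M) (T : vfield M) (n : nat)
    (f : M -> 'rV[R]_n) : Prop :=
  (forall U Z zeta, pseudohermitian_frame H theta T U Z zeta ->
   forall p, U p -> forall v, real_tangent p v ->
     cvec_dot (rumin_map Z zeta f p) (pushforward f v) = 0) /\
  (exists c : R, forall U Z zeta, pseudohermitian_frame H theta T U Z zeta ->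
   forall p, U p -> cvec_length (rumin_map Z zeta f p) = c).

(* Main.v *)
Require Import Defs.
From mathcomp Require Import all_boot all_order all_algebra.
From mathcomp Require Import all_classical all_reals all_analysis.
From mathcomp.real_closed Require Import complex.
From mathcomp Require Import ring.
Set Implicit Arguments.
Unset Strict Implicit.
Unset Printing Implicit Defensive.
Import Order.TTheory GRing.Theory Num.Theory.
Import numFieldNormedType.Exports.
Local Open Scope classical_set_scope.
Local Open Scope ring_scope.
Local Open Scope complex_scope.
(* In ring_scope the same symbol denotes the conjugation of numClosedFieldType,
   which is convertible to conjc on R[i] but is not matched by its lemmas. *)
Local Notation "z ^*" := (conjc z) : ring_scope.

(** The idea is to work in a pseudohermitian frame (Z, Zb, T), Zb the conjugate
    of Z, and to read everything off the bracket relations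
      [Z, Zb] = - i a Z - i conj(a) Zb + i T,   [T, Zb] in span(Z, Zb)
    and the isometry relations
      <Zf, Zf> = 0,   <Zf, Tf> = 0,   <Tf, Tf> = 1.

    Write G for the Garfield-Lee Laplacian of f and Gb for its conjugate. As f
    is real, the Rumin Laplacian is D = G + Gb, and the first bracket relation
    says that G - Gb = - i Tf (garfield_lee_map_sub_conj).

    Isotropy of G implies the assertions on D. For every isometric f, D is
    orthogonal to Zf and Zb f (rumin_dot_frame): applying Zb to <Zf, Zf> = 0
    gives <Gb, Zf> = 0, and G differs from Gb by a multiple of Tf, which is
    orthogonal to Zf. If moreover <G, G> = 0, then <Gb, Gb> = 0, so
      <D, Tf> = i <G + Gb, G - Gb> = 0  and
      <D, D> = 2 <G, Gb> = - <G - Gb, G - Gb> = <Tf, Tf> = 1;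
    hence D is normal of length 1 (isotropic_rumin).

    Pluriharmonicity implies isotropy of G. Locally f = Re h with Zb h = 0. The
    first bracket relation, applied to conj(h), gives G = - (i/2) T conj(h), so
    it is enough that <Th, Th> = 0. Since Zf = Zh / 2, one has <Zh, Zh> = 0. Applying Zb to this
    once gives <Th, Zh> = 0, because Zb Z h = i a Zh - i Th; applying Zb to the
    latter gives <Th, Th> = 0, because Zb T h is a multiple of Zh by the second
    bracket relation (CR_isotropic_Reeb).

    The rest is the calculus that makes these manipulations legitimate: smooth
    functions form an algebra of germs, tangent vectors are derivations of it,
    and the bracket of two smooth vector fields is again such a derivation. *)

(** * The imaginary unit *)

Section ComplexUnit.
Variable R : realType.

Lemma mulii : 'i%C * 'i%C = -1 :> R[i].
Proof. by rewrite -expr2 sqr_i. Qed.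

Lemma imaginary_neq0 : 'i%C != 0 :> R[i].
Proof. by rewrite eq_complex /= oner_eq0 andbF. Qed.

Lemma conj_i : ('i%C : R[i])^* = - 'i%C.
Proof. by apply/eqP; rewrite eq_complex /= oppr0 !eqxx. Qed.

End ComplexUnit.

(** * Smooth functions on open sets of the coordinate space *)

Section CkOn.
Variable R : realType.
Implicit Types (U V : set 'rV[R]_3) (f g : 'rV[R]_3 -> R).

Lemma Ck_on_subset k U V f : V `<=` U -> Ck_on k U f -> Ck_on k V f.
Proof.
elim: k f => [|k IH] f VU /= [cf df]; split=> //; first by move=> x /VU /cf.
  by move=> x /VU /cf.
move=> i; have [dfi Df] := df i; split; first by move=> x /VU /dfi.
exact: IH.
Qed.

(** The product rule expresses a derivative of f * g through f and g themselves,
    so the induction on products has to lower their order by one. *)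
Lemma Ck_on_pred k U f : Ck_on k.+1 U f -> Ck_on k U f.
Proof.
elim: k f => [|k IH] f [cf df]; first by split.
split=> // i; have [dfi Df] := df i; split=> //; exact: IH.
Qed.

Lemma Ck_on_eq k U f g : open U -> (forall x, U x -> f x = g x) ->
  Ck_on k U f -> Ck_on k U g.
Proof.
move=> oU.
have near_fg h1 h2 : (forall x, U x -> h1 x = h2 x :> R) ->
    forall x, U x -> \near x, h1 x = h2 x.
  move=> e x Ux; have := open_nbhs_nbhs (conj oU Ux).
  by apply: filterS => y; exact: e.
have cont h1 h2 : (forall x, U x -> h1 x = h2 x :> R) ->
    (forall x, U x -> {for x, continuous h1}) ->
    forall x, U x -> {for x, continuous h2}.
  move=> e c1 x Ux; suff: h2 @ x --> h1 x by rewrite e.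
  apply: cvg_trans (c1 x Ux); apply: (@near_eq_cvg _ _ (nbhs x)).
  exact: (near_fg _ _ e _ Ux).
elim: k f g => [|k IH] f g fg [cf df].
  by split=> //; exact: cont _ _ fg cf.
split; first exact: cont _ _ fg cf.
move=> i; have [dfi Df] := df i; split.
  move=> x Ux; apply: near_eq_derivable (dfi x Ux); exact: (near_fg _ _ fg _ Ux).
apply: IH Df => x Ux; apply: near_eq_derive; exact: (near_fg _ _ fg _ Ux).
Qed.

Lemma Ck_on_cst k U (c : R) : Ck_on k U (fun=> c).
Proof.
elim: k c => [|k IH] c; first by split=> // x _; exact: cst_continuous.
split=> [x _|i]; first exact: cst_continuous.
split=> [x _|]; first exact: derivable_cst.
suff -> : (fun x => 'D_(delta_mx 0 i) (fun=> c) x) = (fun=> 0 : R) by exact: IH.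
by move=> n; apply: funext => x; exact: derive_cst.
Qed.

Lemma Ck_onD k U f g : open U -> Ck_on k U f -> Ck_on k U g ->
  Ck_on k U (fun x => f x + g x).
Proof.
move=> oU; elim: k f g => [|k IH] f g [cf df] [cg dg].
  by split=> // x Ux; apply: continuousD; [exact: cf|exact: cg].
split=> [x Ux|i]; first by apply: continuousD; [exact: cf|exact: cg].
have [dfi Df] := df i; have [dgi Dg] := dg i; split=> [x Ux|].
  by apply: derivableD; [exact: dfi|exact: dgi].
apply: Ck_on_eq (IH _ _ Df Dg) => // x Ux.
by rewrite -deriveD; [|exact: dfi|exact: dgi].
Qed.

Lemma Ck_onM k U f g : open U -> Ck_on k U f -> Ck_on k U g ->
  Ck_on k U (fun x => f x * g x).
Proof.
move=> oU; elim: k f g => [|k IH] f g Cf Cg;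
  have [cf df] := Cf; have [cg dg] := Cg.
  by split=> // x Ux; apply: continuousM; [exact: cf|exact: cg].
split=> [x Ux|i]; first by apply: continuousM; [exact: cf|exact: cg].
have [dfi Df] := df i; have [dgi Dg] := dg i; split=> [x Ux|].
  by apply: derivableM; [exact: dfi|exact: dgi].
have fDg := IH _ _ (Ck_on_pred Cf) Dg; have gDf := IH _ _ (Ck_on_pred Cg) Df.
apply: Ck_on_eq (Ck_onD oU fDg gDf) => // x Ux.
by rewrite deriveM; [|exact: dfi|exact: dgi].
Qed.

End CkOn.

(** * Smooth functions on the manifold *)

Section Smooth.
Variables (R : realType) (M : manifold3 R).
Implicit Types (U V : set M) (p : M).

(** Smoothness on U is tested on these images; that they are open is what makes
    it a local property. *)
Lemma chart_image_open (c : chart R M) U : open U ->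
  open (c @` (chart_dom c `&` U)).
Proof.
move=> oU; rewrite openE => _ [p [cp Up] <-]; rewrite /interior.
have Icp : (c @` chart_dom c) (c p) by exists p.
have nI := open_nbhs_nbhs (conj (@chart_img_open _ _ c) Icp).
have nU : nbhs (chart_inv c (c p)) U.
  by rewrite chart_invK //; exact: open_nbhs_nbhs.
have nV : nbhs (c p) (chart_inv c @^-1` U) := chart_inv_continuous Icp nU.
apply: filterS (filterI nI nV) => _ [[q cq <-]]; rewrite /= chart_invK // => Uq.
by exists q.
Qed.

Lemma rsmooth_subset U V f : V `<=` U -> rsmooth U f -> rsmooth (M := M) V f.
Proof.
move=> VU sf c ac k; apply: Ck_on_subset (sf c ac k).
by move=> _ [q [cq Vq] <-]; exists q => //; split=> //; exact: VU.
Qed.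

Lemma rsmooth_eq U f g : open U -> (forall p, U p -> f p = g p) ->
  rsmooth U f -> rsmooth (M := M) U g.
Proof.
move=> oU fg sf c ac k; apply: Ck_on_eq (sf c ac k).
  exact: chart_image_open.
by move=> _ [q [cq Uq] <-]; rewrite chart_invK // fg.
Qed.

Lemma rsmooth_cst U (a : R) : rsmooth (M := M) U (fun=> a).
Proof. by move=> c ac k; exact: Ck_on_cst. Qed.

Lemma rsmoothD U f g : open U -> rsmooth U f -> rsmooth U g ->
  rsmooth (M := M) U (fun p => f p + g p).
Proof.
move=> oU sf sg c ac k.
by apply: Ck_onD (sf c ac k) (sg c ac k); exact: chart_image_open.
Qed.

Lemma rsmoothM U f g : open U -> rsmooth U f -> rsmooth U g ->
  rsmooth (M := M) U (fun p => f p * g p).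
Proof.
move=> oU sf sg c ac k.
by apply: Ck_onM (sf c ac k) (sg c ac k); exact: chart_image_open.
Qed.

Lemma rsmoothN U f : open U -> rsmooth U f ->
  rsmooth (M := M) U (fun p => - f p).
Proof.
move=> oU sf; apply: rsmooth_eq (rsmoothM oU (rsmooth_cst U (-1)) sf) => // p _.
by rewrite mulN1r.
Qed.

Lemma csmooth_subset U V f : V `<=` U -> csmooth U f -> csmooth (M := M) V f.
Proof. by move=> VU [? ?]; split; apply: rsmooth_subset; eauto. Qed.

Lemma csmooth_eq U f g : open U -> (forall p, U p -> f p = g p) ->
  csmooth U f -> csmooth (M := M) U g.
Proof.
move=> oU fg [sr si]; split.
- by apply: rsmooth_eq sr => // p /fg ->.
- by apply: rsmooth_eq si => // p /fg ->.
Qed.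

Lemma csmooth_cst U (a : R[i]) : csmooth (M := M) U (fun=> a).
Proof. by split; exact: rsmooth_cst. Qed.

Lemma csmoothD U f g : open U -> csmooth U f -> csmooth U g ->
  csmooth (M := M) U (fun p => f p + g p).
Proof.
move=> oU [fr fi] [gr gi]; split.
- apply: rsmooth_eq (rsmoothD oU fr gr) => // p _.
  by case: (f p) (g p) => [? ?] [].
- apply: rsmooth_eq (rsmoothD oU fi gi) => // p _.
  by case: (f p) (g p) => [? ?] [].
Qed.

Lemma csmoothM U f g : open U -> csmooth U f -> csmooth U g ->
  csmooth (M := M) U (fun p => f p * g p).
Proof.
move=> oU [fr fi] [gr gi]; split.
- apply: rsmooth_eq (rsmoothD oU (rsmoothM oU fr gr)
    (rsmoothN oU (rsmoothM oU fi gi))) => // p _.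
  by case: (f p) (g p) => [? ?] [].
- apply: rsmooth_eq (rsmoothD oU (rsmoothM oU fr gi)
    (rsmoothM oU fi gr)) => // p _.
  by case: (f p) (g p) => [? ?] [].
Qed.

Lemma csmooth_conj U f : open U -> csmooth U f ->
  csmooth (M := M) U (fun p => (f p)^*).
Proof.
move=> oU [fr fi]; split.
- by apply: rsmooth_eq fr => // p _; case: (f p).
- by apply: rsmooth_eq (rsmoothN oU fi) => // p _; case: (f p).
Qed.

Lemma csmooth_at_near p f : csmooth_at p f ->
  \forall q \near p, csmooth_at (M := M) q f.
Proof.
move=> [U [oU Up sf]]; have := open_nbhs_nbhs (conj oU Up).
by apply: filterS => q Uq; exists U.
Qed.

Lemma csmooth_at_eq p f g : csmooth_at p f -> (\forall q \near p, f q = g q) ->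
  csmooth_at (M := M) p g.
Proof.
move=> [U [oU Up sf]] fg.
exists (U `&` interior [set q | f q = g q]); split.
- by apply: openI => //; exact: open_interior.
- by split.
- apply: (@csmooth_eq _ f).
  + by apply: openI => //; exact: open_interior.
  + by move=> q [_ /interior_subset].
  + by apply: csmooth_subset sf => q [].
Qed.

Lemma csmooth_at_cst p (a : R[i]) : csmooth_at (M := M) p (fun=> a).
Proof. by exists setT; split=> //; [exact: openT|exact: csmooth_cst]. Qed.

Lemma csmooth_atD p f g : csmooth_at p f -> csmooth_at p g ->
  csmooth_at (M := M) p (fun q => f q + g q).
Proof.
move=> [U [oU Up sf]] [V [oV Vp sg]]; exists (U `&` V); split=> //.
  exact: openI.
apply: csmoothD; [exact: openI|exact: csmooth_subset sf|exact: csmooth_subset sg].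
Qed.

Lemma csmooth_atM p f g : csmooth_at p f -> csmooth_at p g ->
  csmooth_at (M := M) p (fun q => f q * g q).
Proof.
move=> [U [oU Up sf]] [V [oV Vp sg]]; exists (U `&` V); split=> //.
  exact: openI.
apply: csmoothM; [exact: openI|exact: csmooth_subset sf|exact: csmooth_subset sg].
Qed.

Lemma csmooth_at_conj p f : csmooth_at p f ->
  csmooth_at (M := M) p (fun q => (f q)^*).
Proof.
by move=> [U [oU Up sf]]; exists U; split=> //; exact: csmooth_conj.
Qed.

Lemma csmooth_at_conjE p f : csmooth_at p (fun q => (f q)^*) <->
  csmooth_at (M := M) p f.
Proof.
split=> [/csmooth_at_conj|]; last exact: csmooth_at_conj.
by under eq_fun do rewrite conjcK.
Qed.

Lemma csmooth_at_sum p (I : Type) (r : seq I) (F : I -> M -> R[i]) :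
  (forall j, csmooth_at p (F j)) -> csmooth_at p (fun q => \sum_(j <- r) F j q).
Proof.
move=> sF; elim: r => [|j r IH].
  by under eq_fun do rewrite big_nil; exact: csmooth_at_cst.
by under eq_fun do rewrite big_cons; exact: csmooth_atD.
Qed.

End Smooth.

(** * Tangent vectors as derivations of germs *)

Section Derivations.
Variables (R : realType) (M : manifold3 R) (p : M).
Implicit Types (v w : tvec M) (f g : M -> R[i]).

Lemma ctangent_near v f g : ctangent p v -> csmooth_at p f ->
  (\forall q \near p, f q = g q) -> v f = v g.
Proof.
move=> [_ vE _ _] sf fg; apply: vE => //; exact: csmooth_at_eq fg.
Qed.

Lemma ctangent_cst v (a : R[i]) : ctangent p v -> v (fun=> a) = 0.
Proof.
move=> [_ _ vL vM].
have s1 := csmooth_at_cst p (1 : R[i]); have s0 := csmooth_at_cst p (0 : R[i]).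
have v1 : v (fun=> 1) = 0.
  have := vM _ _ s1 s1; under eq_fun do rewrite mulr1.
  by rewrite mulr1 mul1r => /eqP; rewrite -subr_eq0 opprD addNKr oppr_eq0 => /eqP.
have v0 : v (fun=> 0) = 0.
  have := vM _ _ s0 s0; under eq_fun do rewrite mulr0.
  by rewrite mulr0 mul0r addr0.
have := vL a _ _ s1 s0; under eq_fun do rewrite mulr1 addr0.
by rewrite v1 v0 mulr0 addr0.
Qed.

Lemma ctangentD v f g : ctangent p v -> csmooth_at p f -> csmooth_at p g ->
  v (fun q => f q + g q) = v f + v g.
Proof.
move=> [_ _ vL _] sf sg; have := vL 1 _ _ sf sg; rewrite mul1r.
by under eq_fun do rewrite mul1r.
Qed.

Lemma ctangentZ v (c : R[i]) f : ctangent p v -> csmooth_at p f ->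
  v (fun q => c * f q) = c * v f.
Proof.
move=> tv sf; have [_ _ vL _] := tv.
have := vL c _ _ sf (csmooth_at_cst p 0); rewrite (ctangent_cst _ tv) addr0.
by under eq_fun do rewrite addr0.
Qed.

Lemma ctangentM v f g : ctangent p v -> csmooth_at p f -> csmooth_at p g ->
  v (fun q => f q * g q) = v f * g p + f p * v g.
Proof. by move=> [_ _ _]; exact. Qed.

Lemma ctangent_sum v (I : Type) (r : seq I) (F : I -> M -> R[i]) :
  ctangent p v -> (forall j, csmooth_at p (F j)) ->
  v (fun q => \sum_(j <- r) F j q) = \sum_(j <- r) v (F j).
Proof.
move=> tv sF; elim: r => [|j r IH].
  by under eq_fun do rewrite big_nil; rewrite big_nil ctangent_cst.
under eq_fun do rewrite big_cons.
by rewrite ctangentD ?IH ?big_cons //; exact: csmooth_at_sum.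
Qed.

Lemma ctangent0 : ctangent p (@tzero R M).
Proof. by split=> *; rewrite /tzero ?mulr0 ?mul0r ?addr0. Qed.

Lemma ctangent_tlin (c : R[i]) v w :
  ctangent p v -> ctangent p w -> ctangent p (tlin c v w).
Proof.
move=> [v0 vE vL vM] [w0 wE wL wM]; split; rewrite /tlin.
- by move=> f nf; rewrite v0 // w0 // mulr0 addr0.
- by move=> f g sf sg fg; rewrite (vE _ _ sf sg fg) (wE _ _ sf sg fg).
- by move=> a f g sf sg; rewrite vL // wL //; ring.
- by move=> f g sf sg; rewrite vM // wM //; ring.
Qed.

Lemma ctangent_conj v : ctangent p v -> ctangent p (tconj v).
Proof.
move=> [v0 vE vL vM]; split; rewrite /tconj.
- by move=> f nf; rewrite v0 ?conjc0 // => /csmooth_at_conjE.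
- move=> f g sf sg fg; congr (_^*); apply: vE; try exact: csmooth_at_conj.
  by apply: filterS fg => q ->.
- move=> c f g sf sg.
  under eq_fun do rewrite rmorphD rmorphM.
  rewrite vL; try exact: csmooth_at_conj.
  by rewrite rmorphD rmorphM /= conjcK.
- move=> f g sf sg; under eq_fun do rewrite rmorphM.
  rewrite vM; try exact: csmooth_at_conj.
  by rewrite rmorphD !rmorphM /= !conjcK.
Qed.

End Derivations.

(** * Vector fields and their brackets *)

Section VectorFields.
Variables (R : realType) (M : manifold3 R).
Implicit Types (U V : set M) (X Y : vfield M) (p : M) (f g : M -> R[i]).

Lemma tconjK (v : tvec M) : tconj (tconj v) = v.
Proof.
apply: funext => f; rewrite /tconj conjcK; congr (v _).
by apply: funext => q; rewrite conjcK.
Qed.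

Lemma tconj_tlin (c : R[i]) (v w : tvec M) :
  tconj (tlin c v w) = tlin c^* (tconj v) (tconj w).
Proof. by apply: funext => f; rewrite /tconj /tlin rmorphD rmorphM. Qed.

Lemma tconj0 : tconj (@tzero R M) = @tzero R M.
Proof. by apply: funext => f; rewrite /tconj /tzero conjc0. Qed.

Lemma vfield_csmooth_at U X p f : open U -> U p -> smooth_vfield U X ->
  csmooth_at p f -> csmooth_at p (fun q => X q f).
Proof.
move=> oU Up [_ sX] [V [oV Vp sf]]; exists (U `&` V); split=> //.
  exact: openI.
apply: sX; [exact: openI|by move=> q []|].
by apply: csmooth_subset sf => q [].
Qed.

Lemma smooth_vfield_conj U X : smooth_vfield U X -> smooth_vfield U (fconj X).
Proof.
move=> [tX sX]; split=> [p Up|V f oV VU sf].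
  exact/ctangent_conj/tX.
by apply: csmooth_conj => //; apply: sX => //; exact: csmooth_conj.
Qed.

Definition vfscale (c : R[i]) X : vfield M := fun p => tlin c (X p) (@tzero R M).

Lemma smooth_vfield_scale U (c : R[i]) X : smooth_vfield U X ->
  smooth_vfield U (vfscale c X).
Proof.
move=> [tX sX]; split=> [p Up|V f oV VU sf].
  by apply: ctangent_tlin; [exact: tX|exact: ctangent0].
rewrite /vfscale /tlin; under eq_fun do rewrite addr0.
by apply: csmoothM => //; [exact: csmooth_cst|exact: sX].
Qed.

Lemma bracketE X Y p f : csmooth_at p f ->
  bracket X Y p f = X p (fun q => Y q f) - Y p (fun q => X q f).
Proof. by rewrite /bracket => /asboolP ->. Qed.

Lemma bracketE0 X Y p f : ~ csmooth_at p f -> bracket X Y p f = 0.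
Proof. by rewrite /bracket => /asboolPn/negPf ->. Qed.

(** The usual computation: the cross terms X f * Y g and Y f * X g that
    spoil the Leibniz rule for X Y are symmetric in X and Y. The identities for
    q |-> Y q (f * g) hold only near p, hence the detour by germs. *)
Lemma ctangent_bracket U X Y p : open U -> U p ->
  smooth_vfield U X -> smooth_vfield U Y -> ctangent p (bracket X Y p).
Proof.
move=> oU Up sX sY; have [tX _] := sX; have [tY _] := sY.
have near_tan Z f g : (forall q, U q -> ctangent q (Z q)) -> csmooth_at p f ->
    (\forall q \near p, f q = g q) -> \forall q \near p, Z q f = Z q g.
  move=> tZ sf fg; near=> q; apply: (@ctangent_near _ _ q).
  - by apply: tZ; near: q; exact: open_nbhs_nbhs.
  - by near: q; exact: csmooth_at_near.
  - by near: q; exact: near_join.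
have nearU := open_nbhs_nbhs (conj oU Up).
have sXf f : csmooth_at p f -> csmooth_at p (fun q => X q f).
  exact: vfield_csmooth_at oU Up sX.
have sYf f : csmooth_at p f -> csmooth_at p (fun q => Y q f).
  exact: vfield_csmooth_at oU Up sY.
have tXp := tX _ Up; have tYp := tY _ Up.
split.
- exact: bracketE0.
- move=> f g sf sg fg; rewrite !bracketE //.
  rewrite (ctangent_near tXp (sYf _ sf) (near_tan _ _ _ tY sf fg)).
  by rewrite (ctangent_near tYp (sXf _ sf) (near_tan _ _ _ tX sf fg)).
- move=> c f g sf sg.
  have lin Z : (forall q, U q -> ctangent q (Z q)) ->
      \forall q \near p, c * Z q f + Z q g = Z q (fun q => c * f q + g q).
    move=> tZ; near=> q; have [_ _ -> //] : ctangent q (Z q).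
      by apply: tZ; near: q; exact: open_nbhs_nbhs.
    + by near: q; exact: csmooth_at_near.
    + by near: q; exact: csmooth_at_near.
  have scf h : csmooth_at p h -> csmooth_at p (fun q => c * h q).
    by apply: csmooth_atM; exact: csmooth_at_cst.
  rewrite !bracketE //; last by apply: csmooth_atD => //; exact: scf.
  rewrite -(ctangent_near tXp _ (lin _ tY)); last first.
    by apply: csmooth_atD; [apply: scf|]; exact: sYf.
  rewrite -(ctangent_near tYp _ (lin _ tX)); last first.
    by apply: csmooth_atD; [apply: scf|]; exact: sXf.
  have [sXg sYg] := (sXf _ sg, sYf _ sg); have [sXf' sYf'] := (sXf _ sf, sYf _ sf).
  rewrite (ctangentD tXp) ?(ctangentD tYp) ?(ctangentZ _ tXp) ?(ctangentZ _ tYp) //;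
    try exact: scf.
  by ring.
- move=> f g sf sg.
  have prod Z : (forall q, U q -> ctangent q (Z q)) ->
      \forall q \near p, Z q f * g q + f q * Z q g = Z q (fun q => f q * g q).
    move=> tZ; near=> q; have [_ _ _ -> //] : ctangent q (Z q).
      by apply: tZ; near: q; exact: open_nbhs_nbhs.
    + by near: q; exact: csmooth_at_near.
    + by near: q; exact: csmooth_at_near.
  have sM h k : csmooth_at p h -> csmooth_at p k ->
      csmooth_at p (fun q => h q * k q).
    exact: csmooth_atM.
  have [sXg sYg] := (sXf _ sg, sYf _ sg); have [sXf' sYf'] := (sXf _ sf, sYf _ sf).
  rewrite !bracketE //; last exact: sM.
  rewrite -(ctangent_near tXp _ (prod _ tY)); last by apply: csmooth_atD; exact: sM.
  rewrite -(ctangent_near tYp _ (prod _ tX)); last by apply: csmooth_atD; exact: sM.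
  rewrite (ctangentD tXp) ?(ctangentD tYp) ?(ctangentM tXp) ?(ctangentM tYp) //;
    try exact: sM.
  by ring.
Unshelve. all: by end_near. Qed.

Lemma bracketN X Y p : bracket Y X p = tlin (-1) (bracket X Y p) (@tzero R M).
Proof.
apply: funext => f; rewrite /tlin /tzero addr0 mulN1r.
have [sf|nf] := pselect (csmooth_at p f); last by rewrite !bracketE0 // oppr0.
by rewrite !bracketE // opprB.
Qed.

Lemma tconj_bracket X Y p :
  tconj (bracket X Y p) = bracket (fconj X) (fconj Y) p.
Proof.
apply: funext => f; rewrite {1}/tconj.
have [sf|nf] := pselect (csmooth_at p f); last first.
  by rewrite !bracketE0 ?conjc0 // => /csmooth_at_conjE.
rewrite !bracketE //; last exact: csmooth_at_conj.
rewrite rmorphB /fconj /tconj.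
by congr ((X p _)^* - (Y p _)^*); apply: funext => q; rewrite conjcK.
Qed.

End VectorFields.

(** * The bilinear product and derivatives of vector-valued maps *)

Section DotProduct.
Variables (R : realType) (n : nat).
Implicit Types (x y z : 'rV[R[i]]_n) (c : R[i]).

Lemma cvec_dotC x y : cvec_dot x y = cvec_dot y x.
Proof. by apply: eq_bigr => j _; rewrite mulrC. Qed.

Lemma cvec_dotDl x y z : cvec_dot (x + y) z = cvec_dot x z + cvec_dot y z.
Proof. by rewrite -big_split; apply: eq_bigr => j _; rewrite mxE mulrDl. Qed.

Lemma cvec_dotDr x y z : cvec_dot z (x + y) = cvec_dot z x + cvec_dot z y.
Proof. by rewrite cvec_dotC cvec_dotDl !(cvec_dotC z). Qed.

Lemma cvec_dotZl c x y : cvec_dot (c *: x) y = c * cvec_dot x y.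
Proof.
by rewrite /cvec_dot mulr_sumr; apply: eq_bigr => j _; rewrite mxE mulrA.
Qed.

Lemma cvec_dotZr c x y : cvec_dot x (c *: y) = c * cvec_dot x y.
Proof. by rewrite cvec_dotC cvec_dotZl cvec_dotC. Qed.

Lemma cvec_dotNl x y : cvec_dot (- x) y = - cvec_dot x y.
Proof. by rewrite -scaleN1r cvec_dotZl mulN1r. Qed.

Lemma cvec_dotNr x y : cvec_dot x (- y) = - cvec_dot x y.
Proof. by rewrite -scaleN1r cvec_dotZr mulN1r. Qed.

Lemma cvec_dot0r x : cvec_dot x 0 = 0.
Proof. by rewrite -(scale0r 0) cvec_dotZr mul0r. Qed.

Definition cvec_dotE :=
  (cvec_dotDl, cvec_dotDr, cvec_dotNl, cvec_dotNr, cvec_dotZl, cvec_dotZr).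

Lemma cvec_dot_conj x y :
  cvec_dot (map_mx conjc x) (map_mx conjc y) = (cvec_dot x y)^*.
Proof.
by rewrite /cvec_dot rmorph_sum; apply: eq_bigr => j _; rewrite !mxE rmorphM.
Qed.

Lemma cvec_conjK x : map_mx conjc (map_mx conjc x) = x.
Proof. by apply/rowP => j; rewrite mxE mxE conjcK. Qed.

End DotProduct.

Section DerivativeOfMaps.
Variables (R : realType) (M : manifold3 R) (n : nat).
Implicit Types (v w : tvec M) (X Y : vfield M) (p q : M).
Implicit Types (F G : 'I_n -> M -> R[i]).

(** Vector-valued maps are families F of scalar functions, so that both the
    immersion and its complex-valued derivatives can be differentiated. *)
Definition dmap v F : 'rV[R[i]]_n := \row_j v (F j).

Definition dmap_field X F : 'I_n -> M -> R[i] := fun j q => X q (F j).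

Lemma dmap_tlin (c : R[i]) v w F :
  dmap (tlin c v w) F = c *: dmap v F + dmap w F.
Proof. by apply/rowP => j; rewrite !mxE. Qed.

Lemma dmap0 F : dmap (@tzero R M) F = 0.
Proof. by apply/rowP => j; rewrite !mxE. Qed.

Lemma dmap_conj v F :
  dmap (tconj v) F = map_mx conjc (dmap v (fun j q => (F j q)^*)).
Proof. by apply/rowP => j; rewrite !mxE. Qed.

Lemma dmap_bracket X Y p F : (forall j, csmooth_at p (F j)) ->
  dmap (bracket X Y p) F =
  dmap (X p) (dmap_field Y F) - dmap (Y p) (dmap_field X F).
Proof. by move=> sF; apply/rowP => j; rewrite !mxE bracketE. Qed.

Lemma dmap_near p v F G : ctangent p v -> (forall j, csmooth_at p (F j)) ->
  (\forall q \near p, forall j, F j q = G j q) -> dmap v F = dmap v G.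
Proof.
move=> tv sF FG; apply/rowP => j; rewrite !mxE.
by apply: (ctangent_near tv (sF j)); apply: filterS FG => q; exact.
Qed.

(** Differentiating a product <XF, YG> that is locally constant: the source of
    every orthogonality relation between second derivatives below. *)
Lemma dmap_dot_cst p v F G X Y (c : R[i]) : ctangent p v ->
  (forall j, csmooth_at p (dmap_field X F j)) ->
  (forall j, csmooth_at p (dmap_field Y G j)) ->
  (\forall q \near p, cvec_dot (dmap (X q) F) (dmap (Y q) G) = c) ->
  cvec_dot (dmap v (dmap_field X F)) (dmap (Y p) G) +
  cvec_dot (dmap (X p) F) (dmap v (dmap_field Y G)) = 0.
Proof.
move=> tv sF sG dot_cst.
pose d q := \sum_j dmap_field X F j q * dmap_field Y G j q.
have sFG j : csmooth_at p (fun q => dmap_field X F j q * dmap_field Y G j q).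
  exact: csmooth_atM.
have dE : \forall q \near p, d q = c.
  by apply: filterS dot_cst => q <-; apply: eq_bigr => j _; rewrite !mxE.
have sd : csmooth_at p d by exact: csmooth_at_sum.
have : v d = 0 by rewrite (ctangent_near tv sd dE) (ctangent_cst _ tv).
rewrite (ctangent_sum _ tv) // => <-; rewrite -big_split.
apply: eq_bigr => j _ /=.
by rewrite (ctangentM tv) // !mxE.
Qed.

End DerivativeOfMaps.

(** * Brackets and Levi form in a pseudohermitian frame *)

Section Frame.
Variables (R : realType) (M : manifold3 R) (H : CR_structure M).
Variables (theta : form1 M) (htheta : pseudohermitian H theta).
Variables (T : vfield M) (hT : reeb_field theta T).
Variables (U : set M) (Z : vfield M) (zeta : form1 M).
Hypothesis hZ : pseudohermitian_frame H theta T U Z zeta.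

Let oU : open U. Proof. by case: hZ. Qed.
Let sZ : smooth_vfield U Z. Proof. by case: hZ => _ []. Qed.
Let sZb : smooth_vfield U (fconj Z). Proof. exact: smooth_vfield_conj. Qed.
Let sT : smooth_vfield U T.
Proof.
have [[tT sT] _ _ _] := hT; split=> [p _|V f oV _]; [exact: tT|exact: sT].
Qed.
Let tZ p : U p -> ctangent p (Z p). Proof. by case: sZ => + _; exact. Qed.
Let tZb p : U p -> ctangent p (fconj Z p).
Proof. by case: sZb => + _; exact. Qed.
Let tT p : ctangent p (T p). Proof. by have [[+ _] _ _ _] := hT; exact. Qed.
Let nearU p : U p -> \forall q \near p, U q.
Proof. by move=> Up; exact: open_nbhs_nbhs. Qed.

Lemma form1_0 (om : form1 M) (V : set M) p : smooth_form V om -> V p ->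
  om p (@tzero R M) = 0.
Proof.
move=> [lin _] Vp; have := lin p Vp 1 _ _ (ctangent0 p) (ctangent0 p).
rewrite mul1r (_ : tlin _ _ _ = @tzero R M); last first.
  by apply: funext => f; rewrite /tlin /tzero mulr0 addr0.
by move=> /eqP; rewrite -subr_eq0 opprD addNKr oppr_eq0 => /eqP.
Qed.

Lemma T10_frame p v : U p -> T10 H p v <->
  exists c : R[i], v = tlin c (Z p) (@tzero R M).
Proof.
move=> Up; have [V [Z' [_ Vp _ hE]]] := T10_line_subbundle H p.
have [_ E] := hE p Vp; have [_ [_ TZ] _ sz /(_ p Up) [z1 _ _]] := hZ.
have := TZ p Up; rewrite E => -[c Zc].
have c0 : c != 0.
  apply/eqP => c0; have /eqP : zeta p (Z p) = 0.
    rewrite Zc c0 (_ : tlin _ _ _ = @tzero R M) ?(form1_0 sz) //.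
    by apply: funext => f; rewrite /tlin mul0r add0r.
  by rewrite z1 oner_eq0.
have Z'E : Z' p = tlin c^-1 (Z p) (@tzero R M).
  by apply: funext => f; rewrite Zc /tlin /tzero !addr0 mulKf.
split=> [[d ->]|[d ->]].
- exists (d * c^-1); rewrite Z'E.
  by apply: funext => f; rewrite /tlin /tzero !addr0 mulrA.
- exists (d * c); rewrite Zc.
  by apply: funext => f; rewrite /tlin /tzero !addr0 mulrA.
Qed.

Lemma theta_T10 p z : T10 H p z -> ctangent p z -> theta p z = 0.
Proof.
move=> Tz tz; have [_ _ _ ker] := htheta; apply/(ker p z tz).
have [_ T0] : (T10 H p `&` conj_bundle (T10 H) p) (@tzero R M).
  by rewrite T10_conj_disjoint.
exists z, (@tzero R M); split=> //.
by apply: funext => f; rewrite /tlin /tzero mul1r addr0.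
Qed.

Lemma theta_Z p : U p -> theta p (Z p) = 0.
Proof.
by move=> Up; apply: theta_T10; [case: hZ => _ [_] /(_ p Up)|exact: tZ].
Qed.

Lemma theta_Zb p : U p -> theta p (fconj Z p) = 0.
Proof.
move=> Up; have [_ conj_th _ _] := htheta.
by rewrite conj_th ?theta_Z ?conjc0 //; exact: tZ.
Qed.

(** Subtracting theta(v) T from v leaves a vector in the kernel of theta, that is
    in the span of Z and its conjugate; zeta and its conjugate read off the two
    coefficients. *)
Lemma frame_decomposition p v : U p -> ctangent p v ->
  v = tlin (zeta p v) (Z p) (tlin (zeta p (tconj v))^* (fconj Z p)
        (tlin (theta p v) (T p) (@tzero R M))).
Proof.
move=> Up tv; have [[thL _] _ _ ker] := htheta; have [_ Treal thT _] := hT.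
have [_ _ _ [zL sz'] /(_ p Up) [zZ zZb zT]] := hZ.
have sz : smooth_form U zeta by [].
have tt : ctangent p (tlin (- theta p v) (T p) v) by exact: ctangent_tlin.
have /(ker p _ tt)[z [w [Tz [w' Tw' <-] E]]] :
    theta p (tlin (- theta p v) (T p) v) = 0.
  by rewrite thL // thT mulr1 addNr.
have [a za] := (T10_frame z Up).1 Tz; have [b wb] := (T10_frame w' Up).1 Tw'.
have vE : v = tlin a (Z p) (tlin b^* (fconj Z p)
    (tlin (theta p v) (T p) (@tzero R M))).
  apply: funext => f; have := congr1 (fun t => t f) E.
  rewrite wb za tconj_tlin tconj0 /tlin /tzero /fconj !addr0 mul1r => e.
  by rewrite addrA -e; ring.
have z0 := form1_0 sz Up; have t0 := ctangent0 p.
have tZp := tZ Up; have tZbp := tZb Up; have tTp := tT p.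
have tl1 (c : R[i]) : ctangent p (tlin c (T p) (@tzero R M)).
  exact: ctangent_tlin.
have tl2 (c c' : R[i]) :
    ctangent p (tlin c (fconj Z p) (tlin c' (T p) (@tzero R M))).
  exact: ctangent_tlin.
have tl3 (c c' : R[i]) :
    ctangent p (tlin c (Z p) (tlin c' (T p) (@tzero R M))).
  exact: ctangent_tlin.
have zv : zeta p v = a.
  rewrite vE zL // zL // zL //.
  by rewrite zZ zZb zT z0 !mulr0 !addr0 mulr1.
have zvb : zeta p (tconj v) = b.
  rewrite vE !tconj_tlin tconj0 conjcK /fconj tconjK Treal -/(fconj Z p).
  rewrite zL // zL // zL //.
  by rewrite zZ zZb zT z0 !mulr0 !addr0 add0r mulr1.
by rewrite {1}vE zv zvb.
Qed.

(** Covers all frame fields, on which theta is 0 or 1. *)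
Lemma dform_constant X Y p : U p -> smooth_vfield U X -> smooth_vfield U Y ->
  (exists c, forall q, U q -> theta q (X q) = c) ->
  (exists c, forall q, U q -> theta q (Y q) = c) ->
  dform theta X Y p = - theta p (bracket X Y p).
Proof.
move=> Up sX sY [c cX] [d dY]; have [[_ sth] _ _ _] := htheta.
have tX : ctangent p (X p) by case: sX => + _; exact.
have tY : ctangent p (Y p) by case: sY => + _; exact.
have sthX : csmooth_at p (fun q => theta q (X q)).
  by exists U; split=> //; exact: sth.
have sthY : csmooth_at p (fun q => theta q (Y q)).
  by exists U; split=> //; exact: sth.
rewrite /dform (ctangent_near (g := fun=> d) tX sthY);
  last by apply: filterS (nearU Up).
rewrite (ctangent_near (g := fun=> c) tY sthX);
  last by apply: filterS (nearU Up).
by rewrite !(ctangent_cst (p := p)) // subrr add0r.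
Qed.

(* The side conditions of dform_constant for the frame fields. *)
Let theta_Z_cst : exists c, forall q, U q -> theta q (Z q) = c.
Proof. by exists 0 => q Uq; rewrite theta_Z. Qed.
Let theta_Zb_cst : exists c, forall q, U q -> theta q (fconj Z q) = c.
Proof. by exists 0 => q Uq; rewrite theta_Zb. Qed.
Let theta_T_cst : exists c, forall q, U q -> theta q (T q) = c.
Proof. by have [_ _ thT _] := hT; exists 1 => q _. Qed.

Lemma theta_bracket_ZZb p : U p -> theta p (bracket Z (fconj Z) p) = 'i%C.
Proof.
move=> Up; have [_ _ /(_ p Up) + _ _] := hZ.
rewrite /levi dform_constant // mulrN => e.
by rewrite -[LHS]mul1r -[1]opprK -mulii mulNr -mulrA -mulrN e mulr1.
Qed.

(** The coefficient of conj Z follows from that of Z, because conjugation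
    changes the sign of the bracket. *)
Lemma bracket_ZZb p : U p -> let a := frame_coef Z zeta p in
  bracket Z (fconj Z) p = tlin (- ('i%C * a)) (Z p)
    (tlin (- ('i%C * a^*)) (fconj Z p) (tlin 'i%C (T p) (@tzero R M))).
Proof.
move=> Up a; have tb := ctangent_bracket oU Up sZ sZb.
have [_ _ _ [zL sz'] _] := hZ; have sz : smooth_form U zeta by [].
have ab : zeta p (bracket Z (fconj Z) p) = - ('i%C * a).
  by rewrite /a /frame_coef mulrA mulii mulN1r opprK.
rewrite {1}(frame_decomposition Up tb) theta_bracket_ZZb // ab.
congr (tlin _ _ (tlin _ _ _)).
rewrite tconj_bracket (_ : fconj (fconj Z) = Z); last first.
  by apply: funext => q; exact: tconjK.
rewrite bracketN zL //; last exact: ctangent0.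
rewrite (form1_0 sz Up) ab addr0 mulN1r opprK rmorphM /= -mulNr; congr (_ * _).
by apply/eqP; rewrite eq_complex /= oppr0 !eqxx.
Qed.

(** There is no component along T, because T annihilates the differential of
    theta. *)
Lemma bracket_TZb p : U p -> exists b c : R[i],
  bracket T (fconj Z) p = tlin b (Z p) (tlin c (fconj Z p) (@tzero R M)).
Proof.
move=> Up; have tb := ctangent_bracket oU Up sT sZb.
have [_ _ _ /(_ U (fconj Z) oU sZb p Up)] := hT.
rewrite dform_constant // => /eqP; rewrite oppr_eq0 => /eqP th0.
exists (zeta p (bracket T (fconj Z) p)).
exists (zeta p (tconj (bracket T (fconj Z) p)))^*.
rewrite {1}(frame_decomposition Up tb) th0; congr (tlin _ _ (tlin _ _ _)).
by apply: funext => f; rewrite /tlin mul0r add0r.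
Qed.

Lemma dmap_bracket_ZZb p m (h : 'I_m -> M -> R[i]) : U p ->
  (forall j, csmooth_at p (h j)) -> let a := frame_coef Z zeta p in
  dmap (Z p) (dmap_field (fconj Z) h) - dmap (fconj Z p) (dmap_field Z h) =
  - ('i%C * a) *: dmap (Z p) h + - ('i%C * a^*) *: dmap (fconj Z p) h
  + 'i%C *: dmap (T p) h.
Proof.
move=> Up sh a; rewrite -dmap_bracket // bracket_ZZb // !dmap_tlin dmap0 addr0.
by rewrite addrA.
Qed.

(** The metric is prescribed on real parts of sections only; the sections c Z
    with c constant are enough to recover its complex bilinear extension. *)
Lemma levi_scale (c d : R[i]) p : U p ->
  levi theta (vfscale c Z) (vfscale d Z) p = c * d^*.
Proof.
move=> Up; have [[thL sth'] _ _ _] := htheta.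
have sth : smooth_form setT theta by [].
have th0 q (e : R[i]) (v : tvec M) : ctangent q v -> theta q v = 0 ->
    theta q (tlin e v (@tzero R M)) = 0.
  move=> tv t0; rewrite thL //; last exact: ctangent0.
  by rewrite t0 (form1_0 sth) // mulr0 addr0.
have conjE : fconj (vfscale d Z) = vfscale d^* (fconj Z).
  by apply: funext => q; rewrite /fconj tconj_tlin tconj0.
have brE : bracket (vfscale c Z) (vfscale d^* (fconj Z)) p =
    tlin (c * d^*) (bracket Z (fconj Z) p) (@tzero R M).
  apply: funext => f; rewrite /tlin /tzero addr0.
  have [sf|nf] := pselect (csmooth_at p f); last by rewrite !bracketE0 // mulr0.
  rewrite !bracketE // /vfscale /tlin /tzero !addr0.
  under eq_fun do rewrite addr0.
  under [X in fconj Z p X]eq_fun do rewrite addr0.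
  have sZf := vfield_csmooth_at oU Up sZ sf.
  have sZbf := vfield_csmooth_at oU Up sZb sf.
  by rewrite (ctangentZ _ (tZ Up)) // (ctangentZ _ (tZb Up)) //; ring.
rewrite /levi conjE dform_constant //; try exact: smooth_vfield_scale.
- rewrite brE thL //; [|exact: ctangent_bracket oU Up sZ sZb|exact: ctangent0].
  rewrite (form1_0 sth) // addr0 theta_bracket_ZZb // mulrN mulrCA.
  by rewrite mulii mulrN1 opprK.
- by exists 0 => q Uq; apply: th0; [exact: tZ|exact: theta_Z].
- by exists 0 => q Uq; apply: th0; [exact: tZb|exact: theta_Zb].
Qed.

(** * Isometric immersions *)

Section Isometric.
Variables (g : metric_tensor M) (hg : webster_metric H theta T g).
Variables (n : nat) (f : M -> 'rV[R]_n) (hiso : isometric g f).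

Let r : R[i] := ((Num.sqrt (2 : R))%:C)^-1.
Let r_real : r^* = r. Proof. by rewrite /r conjc_inv conjc_real. Qed.
Let r2 : r * r = 2^-1.
Proof.
by rewrite /r -invfM -rmorphM -expr2 sqr_sqrtr ?ler0n // rmorph_nat.
Qed.
Let real_partE (z : tvec M) :
  real_part z = tlin r z (tlin r (tconj z) (@tzero R M)).
Proof. by apply: funext => u; rewrite /real_part /tlin /tzero addr0 -/r; ring. Qed.

Let real_part_tangent p (z : tvec M) :
  ctangent p z -> real_tangent p (real_part z).
Proof.
move=> tz; rewrite real_partE; split.
  apply: ctangent_tlin => //; apply: ctangent_tlin; last exact: ctangent0.
  exact: ctangent_conj.
apply: funext => u; rewrite !tconj_tlin tconj0 tconjK r_real /tlin /tzero; ring.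
Qed.

Local Notation Df v := (dmap v (componentC f)).

Let pushforwardE (v : tvec M) : Defs.pushforward f v = Df v. Proof. by []. Qed.

Let T_real p : real_tangent p (T p).
Proof. by have [_ Treal _ _] := hT. Qed.

Let Df_real_part (c : R[i]) p :
  Df (real_part (vfscale c Z p)) = r *: (c *: Df (Z p) + c^* *: Df (fconj Z p)).
Proof.
by rewrite real_partE tconj_tlin tconj0 !dmap_tlin dmap0 !addr0 scalerDr.
Qed.

Let section_scale (c : R[i]) : section_of (T10 H) U (vfscale c Z).
Proof.
split; first exact: smooth_vfield_scale.
by move=> q Uq; apply/(T10_frame _ Uq); exists c.
Qed.

Let dot_real_part (c d : R[i]) p : U p ->
  cvec_dot (c *: Df (Z p) + c^* *: Df (fconj Z p))
           (d *: Df (Z p) + d^* *: Df (fconj Z p)) =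
  2 * (complex.Re (c * d^*))%:C.
Proof.
move=> Up; have tzc (e : R[i]) : ctangent p (vfscale e Z p).
  by have [[+ _] _] := section_scale e; exact.
have [_ /(_ U _ _ oU (section_scale c) (section_scale d) p Up) + _ _] := hg.
rewrite levi_scale // => <-.
rewrite -(hiso (real_part_tangent (tzc c)) (real_part_tangent (tzc d))).
rewrite !pushforwardE !Df_real_part [in RHS]cvec_dotZl [in RHS]cvec_dotZr.
by rewrite !mulrA -[2 * r * r]mulrA r2 divff ?mul1r // pnatr_eq0.
Qed.

Let conj1 : (1 : R[i])^* = 1. Proof. exact: conjc1. Qed.

(** The complex bilinear extension of the metric vanishes on T10: polarize the
    isometry condition on the real parts of Z and i Z. *)
Lemma isotropic_Z p : U p -> cvec_dot (Df (Z p)) (Df (Z p)) = 0.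
Proof.
move=> Up; set A := cvec_dot _ _.
set B := cvec_dot (Df (Z p)) (Df (fconj Z p)).
set C := cvec_dot (Df (fconj Z p)) (Df (fconj Z p)).
(* The values (1, 1), (i, 1) and (i, i) of (c, d) determine A, B and C. *)
have E (c d : R[i]) :
    c * d * A + (c * d^* + c^* * d) * B + c^* * d^* * C =
    2 * (complex.Re (c * d^*))%:C.
  rewrite -(dot_real_part c d Up) !cvec_dotE.
  rewrite (cvec_dotC (Df (fconj Z p)) (Df (Z p))).
  by rewrite -/A -/B -/C; ring.
have e1 : A + 2 * B + C = 2.
  by have := E 1 1; rewrite conj1 !mulr1 !mul1r.
have e2 : A = C.
  have := E 'i%C 1; rewrite conj1 !mulr1 conj_i addrN mul0r addr0 /= mulr0.
  rewrite mulNr -mulrBr => /eqP.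
  by rewrite mulf_eq0 (negPf (imaginary_neq0 R)) subr_eq0 => /eqP.
have e3 : - A + 2 * B - C = 2.
  have := E 'i%C 'i%C; rewrite conj_i mulrNN mulNr mulrN mulii opprK /= mulr1.
  by move=> e; rewrite -[RHS]e; ring.
apply: (mulfI (x := 4)); first by rewrite pnatr_eq0.
transitivity ((A + 2 * B + A) - (- A + 2 * B - A)); first by ring.
by rewrite {2 4}e2 e1 e3; ring.
Qed.

Lemma metric_Reeb p : U p ->
  cvec_dot (Df (Z p)) (Df (T p)) = 0 /\ cvec_dot (Df (T p)) (Df (T p)) = 1.
Proof.
move=> Up; have [_ _ gT gTT] := hg.
set P := cvec_dot (Df (Z p)) _.
set Q := cvec_dot (Df (fconj Z p)) (Df (T p)).
(* Taking c = 1 and c = i separates P from Q. *)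
have E (c : R[i]) : c * P + c^* * Q = 0.
  have [[tc _] Tc] := section_scale c.
  have := hiso (real_part_tangent (tc p Up)) (T_real p).
  rewrite gT; last exact: Tc.
  rewrite !pushforwardE Df_real_part !cvec_dotE -/P -/Q => /eqP.
  rewrite mulf_eq0 => /orP[/eqP r0|/eqP //].
  have := r2; rewrite r0 mul0r => /esym/eqP; rewrite invr_eq0.
  by rewrite pnatr_eq0.
have e1 : P = - Q.
  by have /eqP := E 1; rewrite conj1 !mul1r addr_eq0 => /eqP.
have e2 : P = Q.
  have /eqP := E 'i%C; rewrite conj_i mulNr -mulrBr mulf_eq0.
  by rewrite (negPf (imaginary_neq0 R)) subr_eq0 => /eqP.
have Q0 : Q = 0.
  apply: (mulfI (x := 2)); first by rewrite pnatr_eq0.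
  by rewrite mulr0 mulr_natl mulr2n -{1}e2 e1 addNr.
split=> //; first by rewrite e2.
by rewrite (hiso (T_real p) (T_real p)) gTT.
Qed.

Hypothesis himm : immersion f.

Let sf q j : csmooth_at q (componentC f j).
Proof.
have [sf _] := himm; exists setT; split=> //; first exact: openT.
by split; [exact: sf|exact: rsmooth_cst].
Qed.

Let Df_conj v : Df (tconj v) = map_mx conjc (Df v).
Proof.
rewrite dmap_conj; congr (map_mx _ (dmap v _)).
by apply: funext => j; apply: funext => q; rewrite conjc_real.
Qed.

Let fconj_component q j :
  fconj Z q (componentC f j) = (Z q (componentC f j))^*.
Proof.
rewrite /fconj /tconj; congr ((Z q _)^*).
by apply: funext => q'; rewrite conjc_real.
Qed.

Local Notation G p := (garfield_lee_map Z zeta f p).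

Lemma garfield_lee_mapE p :
  G p = - (dmap (Z p) (dmap_field (fconj Z) (componentC f)) +
           ('i%C * (frame_coef Z zeta p)^*) *: Df (fconj Z p)).
Proof. by apply/rowP => j; rewrite !mxE. Qed.

Lemma conj_garfield_lee_map p : map_mx conjc (G p) =
  - (dmap (fconj Z p) (dmap_field Z (componentC f)) -
     ('i%C * frame_coef Z zeta p) *: Df (Z p)).
Proof.
have conjM (x y : R[i]) : (x * y)^* = x^* * y^* by exact: rmorphM.
have conjE (x y a : R[i]) : (- (x + 'i%C * a^* * y))^* = - (x^* - 'i%C * a * y^*).
  have -> : (- (x + 'i%C * a^* * y))^* = - (x^* + ('i%C * a^* * y)^*).
    by rewrite -[in RHS](rmorphD conjc) -[RHS](rmorphN conjc).
  by rewrite !conjM conjcK conj_i !mulNr.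
apply/rowP => j; rewrite !mxE [LHS]conjE; congr (- (_^* - _ * _)).
- by congr (Z p _); apply: funext => q; rewrite fconj_component.
- by rewrite fconj_component conjcK.
Qed.

Lemma rumin_mapE p : rumin_map Z zeta f p = G p + map_mx conjc (G p).
Proof.
rewrite conj_garfield_lee_map garfield_lee_mapE.
by apply/rowP => j; rewrite !mxE /rumin /dmap_field; ring.
Qed.

Lemma rumin_map_real p :
  map_mx conjc (rumin_map Z zeta f p) = rumin_map Z zeta f p.
Proof. by rewrite rumin_mapE map_mxD cvec_conjK addrC. Qed.

(** The second-order part of G - conj G is minus the bracket of Z and conj Z;
    the first-order terms of G cancel its components along Z and conj Z. *)
Lemma garfield_lee_map_sub_conj p : U p ->
  G p - map_mx conjc (G p) = - 'i%C *: Df (T p).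
Proof.
move=> Up; rewrite conj_garfield_lee_map garfield_lee_mapE.
have := dmap_bracket_ZZb Up (sf p).
set X := dmap (Z p) _; set Y := dmap (fconj Z p) (dmap_field _ _).
set a := frame_coef _ _ _ => /rowP E; apply/rowP => j; have := E j.
rewrite !mxE; set x := Z p _; set y := fconj Z p _ => {}E.
transitivity (- (x - y) - 'i%C * a * dmap (Z p) (componentC f) 0 j
  - 'i%C * a^* * dmap (fconj Z p) (componentC f) 0 j).
  by rewrite !mxE; ring.
by rewrite E !mxE; ring.
Qed.

(** This holds for every isometric immersion: the Rumin Laplacian can fail to be
    normal only in the Reeb direction. *)
Lemma rumin_dot_frame p : U p ->
  cvec_dot (rumin_map Z zeta f p) (Df (Z p)) = 0 /\
  cvec_dot (rumin_map Z zeta f p) (Df (fconj Z p)) = 0.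
Proof.
move=> Up; have ZZ := isotropic_Z Up; have [TZ _] := metric_Reeb Up.
have sZf j : csmooth_at p (dmap_field Z (componentC f) j).
  exact: vfield_csmooth_at oU Up sZ (sf p j).
have nearZZ : \forall q \near p, cvec_dot (Df (Z q)) (Df (Z q)) = 0.
  by apply: filterS (nearU Up) => q /isotropic_Z.
have dZZ :
    cvec_dot (dmap (fconj Z p) (dmap_field Z (componentC f))) (Df (Z p)) = 0.
  have := dmap_dot_cst (tZb Up) sZf sZf nearZZ.
  rewrite [X in _ + X]cvec_dotC -mulr2n => /eqP.
  by rewrite mulrn_eq0 /= => /eqP.
have GbZ : cvec_dot (map_mx conjc (G p)) (Df (Z p)) = 0.
  by rewrite conj_garfield_lee_map !cvec_dotE dZZ ZZ mulr0 subrr oppr0.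
have GZ : cvec_dot (G p) (Df (Z p)) = 0.
  rewrite -[G p](subrK (map_mx conjc (G p))) garfield_lee_map_sub_conj //.
  by rewrite cvec_dotDl GbZ cvec_dotZl cvec_dotC TZ mulr0 addr0.
have DZ : cvec_dot (rumin_map Z zeta f p) (Df (Z p)) = 0.
  by rewrite rumin_mapE cvec_dotDl GZ GbZ addr0.
by split=> //; rewrite -rumin_map_real Df_conj cvec_dot_conj DZ conjc0.
Qed.

(** With Tf = i (G - conj G) and the Rumin Laplacian equal to G + conj G, both
    conclusions are identities between the products of G and conj G. *)
Lemma isotropic_rumin p : U p -> cvec_dot (G p) (G p) = 0 ->
  (forall v, real_tangent p v ->
     cvec_dot (rumin_map Z zeta f p) (Df v) = 0) /\
  cvec_length (rumin_map Z zeta f p) = 1.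
Proof.
move=> Up GG; have [DZ DZb] := rumin_dot_frame Up.
have GbGb : cvec_dot (map_mx conjc (G p)) (map_mx conjc (G p)) = 0.
  by rewrite cvec_dot_conj GG conjc0.
have DfT : Df (T p) = 'i%C *: (G p - map_mx conjc (G p)).
  by rewrite garfield_lee_map_sub_conj // scalerA mulrN mulii opprK scale1r.
have DT : cvec_dot (rumin_map Z zeta f p) (Df (T p)) = 0.
  rewrite DfT rumin_mapE !cvec_dotE GG GbGb (cvec_dotC (map_mx conjc _)).
  ring.
have DD : cvec_dot (rumin_map Z zeta f p) (rumin_map Z zeta f p) = 1.
  have [_ <-] := metric_Reeb Up.
  rewrite DfT rumin_mapE !cvec_dotE GG GbGb (cvec_dotC (map_mx conjc _)).
  rewrite -mulrBr mulrA mulii.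
  ring.
split=> [v [tv _]|].
  rewrite (frame_decomposition Up tv) !dmap_tlin dmap0 !cvec_dotE DZ DZb DT.
  by rewrite cvec_dot0r; ring.
(* The length is the Hermitian norm; it agrees with the bilinear square because
   the Rumin Laplacian of a real map is real. *)
rewrite /cvec_length -[RHS]sqrtr1; congr Num.sqrt; apply: complexI.
rewrite rmorph_sum rmorph1 -DD; apply: eq_bigr => j _.
have : (rumin_map Z zeta f p 0 j)^* = rumin_map Z zeta f p 0 j.
  by have /rowP/(_ j) := rumin_map_real p; rewrite mxE.
case: (rumin_map _ _ _ _ _ _) => x y /= [/eqP].
rewrite eq_sym -addr_eq0 -mulr2n mulrn_eq0 /= => /eqP ->.
apply/eqP; rewrite eq_complex /=.
by rewrite expr2 !mulr0 !mul0r subr0 addr0 expr2 mulr0 addr0 !eqxx.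
Qed.

(** A CR map that is isotropic along Z is isotropic along T: each application of
    conj Z to <Zh, Zh> = 0 trades one factor Zh for - i Th, up to terms that
    vanish already. *)
Lemma CR_isotropic_Reeb (h : 'I_n -> M -> R[i]) p : U p ->
  (\forall q \near p, [/\ forall j, csmooth_at q (h j),
     dmap (fconj Z q) h = 0 & cvec_dot (dmap (Z q) h) (dmap (Z q) h) = 0]) ->
  cvec_dot (dmap (T p) h) (dmap (T p) h) = 0.
Proof.
move=> Up nearh.
have Zb_dmap X q : U q -> ctangent q (X q) ->
    (\forall q' \near q, dmap (fconj Z q') h = 0) ->
    (forall j, csmooth_at q (h j)) -> dmap (X q) (dmap_field (fconj Z) h) = 0.
  move=> Uq tX nq sh; rewrite (dmap_near (G := fun _ _ => 0) tX); first last.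
  - by apply: filterS nq => q' /rowP E j; have := E j; rewrite !mxE.
  - by move=> j; exact: vfield_csmooth_at oU Uq sZb (sh j).
  - by apply/rowP => j; rewrite !mxE (ctangent_cst _ tX).
(* conj Z (Z h) is minus the bracket of Z and conj Z applied to h. *)
have dZ q : U q -> (\forall q' \near q, [/\ forall j, csmooth_at q' (h j),
     dmap (fconj Z q') h = 0 & cvec_dot (dmap (Z q') h) (dmap (Z q') h) = 0]) ->
    dmap (fconj Z q) (dmap_field Z h) =
    ('i%C * frame_coef Z zeta q) *: dmap (Z q) h - 'i%C *: dmap (T q) h.
  move=> Uq nq; have [sh Zbh _] := nbhs_singleton nq.
  have ZZbh : dmap (Z q) (dmap_field (fconj Z) h) = 0.
    by apply: Zb_dmap => //; [exact: tZ|apply: filterS nq => q' []].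
  have := dmap_bracket_ZZb Uq sh; rewrite ZZbh Zbh => /rowP E; apply/rowP => j.
  have := E j; rewrite !mxE => {}E.
  by rewrite -[LHS]opprK -[X in - X]sub0r E; ring.
have TZ : \forall q \near p, cvec_dot (dmap (T q) h) (dmap (Z q) h) = 0.
  apply: filterS2 (nearU Up) (near_join nearh) => q Uq nq.
  have [sh Zbh ZZh] := nbhs_singleton nq.
  have sZh j : csmooth_at q (dmap_field Z h j).
    exact: vfield_csmooth_at oU Uq sZ (sh j).
  have nZZ : \forall q' \near q, cvec_dot (dmap (Z q') h) (dmap (Z q') h) = 0.
    by apply: filterS nq => q' [].
  have := dmap_dot_cst (tZb Uq) sZh sZh nZZ.
  rewrite [X in _ + X]cvec_dotC -mulr2n => /eqP.
  rewrite mulrn_eq0 /= (dZ _ Uq nq) !cvec_dotE ZZh mulr0 add0r oppr_eq0 mulf_eq0.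
  by rewrite (negPf (imaginary_neq0 R)) => /eqP.
have [sh Zbh ZZh] := nbhs_singleton nearh.
have sZh j : csmooth_at p (dmap_field Z h j).
  exact: vfield_csmooth_at oU Up sZ (sh j).
have sTh j : csmooth_at p (dmap_field T h j).
  exact: vfield_csmooth_at oU Up sT (sh j).
have := dmap_dot_cst (tZb Up) sTh sZh TZ.
(* conj Z (T h) is minus the bracket of T and conj Z, hence a multiple of Zh. *)
have [b [c E]] := bracket_TZb Up.
have := dmap_bracket T (fconj Z) sh.
rewrite E !dmap_tlin dmap0 Zbh scaler0 !addr0.
rewrite Zb_dmap //; last by apply: filterS nearh => q' [].
rewrite sub0r => /eqP; rewrite -eqr_oppLR => /eqP <-.
rewrite (dZ _ Up nearh) !cvec_dotE ZZh (nbhs_singleton TZ) !mulr0 oppr0 !add0r.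
by move=> /eqP; rewrite oppr_eq0 mulf_eq0 (negPf (imaginary_neq0 R)) => /eqP.
Qed.

(** Only conj h contributes to G, and there the bracket relation turns the second
    derivative into a first one: G = - (i/2) T conj h. *)
Lemma pluriharmonic_isotropic p : U p -> pluriharmonic_map H f ->
  cvec_dot (G p) (G p) = 0.
Proof.
move=> Up hf.
(* The components of f come with CR functions on different open sets; finitely
   many of them share a neighbourhood of p. *)
have [h nh] : exists h : 'I_n -> M -> R[i], \forall q \near p, forall j,
    [/\ csmooth_at q (h j), fconj Z q (h j) = 0 & f q 0 j = complex.Re (h j q)].
  have loc j : exists h, \forall q \near p,
      [/\ csmooth_at q h, fconj Z q h = 0 & f q 0 j = complex.Re (h q)].
    have [V [h [oV Vp [sh CRh] fh]]] := hf j p; exists h.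
    have nV : \forall q \near p, V q by exact: open_nbhs_nbhs.
    apply: filterS2 (nearU Up) nV => q Uq Vq; split; [by exists V| |exact: fh].
    by case: hZ => _ [_ TZ] _ _ _; exact: (CRh q (Z q) Vq (TZ q Uq)).
  have [h hP] := choice loc; exists h; exact: filter_forall.
pose hb j q := (h j q)^*.
have fh : \forall q \near p, forall j,
    componentC f j q = 2^-1 * h j q + 2^-1 * hb j q.
  apply: filterS nh => q + j => /(_ j)[_ _ fq].
  by rewrite /componentC fq /hb ReJ_add mulrC mulrDr.
have half (v : tvec M) q : ctangent q v -> (forall j, csmooth_at q (h j)) ->
    (\forall q' \near q, forall j,
       componentC f j q' = 2^-1 * h j q' + 2^-1 * hb j q') ->
    Df v = 2^-1 *: dmap v h + 2^-1 *: dmap v hb.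
  move=> tv sh nq; have shb j : csmooth_at q (hb j) by exact: csmooth_at_conj.
  rewrite (dmap_near tv (sf q) nq); apply/rowP => j; rewrite !mxE.
  have sc u : csmooth_at q u -> csmooth_at q (fun q' => 2^-1 * u q').
    by apply: csmooth_atM; exact: csmooth_at_cst.
  by rewrite (ctangentD tv) ?(ctangentZ _ tv) //; exact: sc.
have Z_hb q : (forall j, fconj Z q (h j) = 0) -> dmap (Z q) hb = 0.
  move=> Zbh; apply/rowP => j; rewrite !mxE -[LHS]conjcK.
  by rewrite -[RHS]conjc0; congr (_^*); exact: Zbh.
have nU := nearU Up.
have nDf : \forall q \near p, [/\ U q,
   (forall j, csmooth_at q (h j)) /\ dmap (fconj Z q) h = 0, dmap (Z q) hb = 0,
   Df (Z q) = 2^-1 *: dmap (Z q) h &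
   Df (fconj Z q) = 2^-1 *: dmap (fconj Z q) hb].
  apply: filterS3 nU nh (near_join fh) => q Uq hq nq.
  have sh j : csmooth_at q (h j) by case: (hq j).
  have Zbh j : fconj Z q (h j) = 0 by case: (hq j).
  have Zbh0 : dmap (fconj Z q) h = 0 by apply/rowP => j; rewrite !mxE.
  split=> //; first exact: Z_hb.
    by rewrite (half _ _ (tZ Uq) sh nq) Z_hb // scaler0 addr0.
  by rewrite (half _ _ (tZb Uq) sh nq) Zbh0 scaler0 add0r.
have TT : cvec_dot (dmap (T p) h) (dmap (T p) h) = 0.
  apply: CR_isotropic_Reeb => //.
  apply: filterS nDf => q [Uq [sh Zbh] _ Zf _]; split=> //.
  have := isotropic_Z Uq; rewrite Zf !cvec_dotE => /eqP.
  by rewrite !mulf_eq0 invr_eq0 pnatr_eq0 /= => /eqP.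
have [_ [sh Zbh] Zhb Zf Zbf] := nbhs_singleton nDf.
have shb j : csmooth_at p (hb j) by exact: csmooth_at_conj.
have ZZbf : dmap (Z p) (dmap_field (fconj Z) (componentC f)) =
    2^-1 *: dmap (Z p) (dmap_field (fconj Z) hb).
  have sZbhb j : csmooth_at p (dmap_field (fconj Z) hb j).
    exact: vfield_csmooth_at oU Up sZb (shb j).
  rewrite (dmap_near (G := fun j q => 2^-1 * dmap_field (fconj Z) hb j q)
    (tZ Up)).
  - by apply/rowP => j; rewrite !mxE (ctangentZ _ (tZ Up)).
  - by move=> j; exact: vfield_csmooth_at oU Up sZb (sf p j).
  - by apply: filterS nDf => q [_ _ _ _ /rowP E] j; have := E j; rewrite !mxE.
have ZbZhb : dmap (fconj Z p) (dmap_field Z hb) = 0.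
  rewrite (dmap_near (G := fun _ _ => 0) (tZb Up)).
  - by apply/rowP => j; rewrite !mxE (ctangent_cst _ (tZb Up)).
  - by move=> j; exact: vfield_csmooth_at oU Up sZ (shb j).
  - by apply: filterS nDf => q [_ _ /rowP E _ _] j; have := E j; rewrite !mxE.
have GE : G p = (- ('i%C / 2)) *: dmap (T p) hb.
  have := dmap_bracket_ZZb Up shb; rewrite ZbZhb Zhb => /rowP E.
  rewrite garfield_lee_mapE ZZbf Zbf; apply/rowP => j; have := E j.
  by rewrite !mxE oppr0 addr0 => ->; ring.
have Thb : dmap (T p) hb = map_mx conjc (dmap (T p) h).
  have [_ Treal _ _] := hT; rewrite -[in LHS]Treal dmap_conj.
  congr (map_mx _ (dmap _ _)).
  by apply: funext => j; apply: funext => q; rewrite conjcK.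
by rewrite GE Thb !cvec_dotE cvec_dot_conj TT conjc0 !mulr0.
Qed.

End Isometric.
End Frame.

Theorem proposition4p2 (R : realType) (M : manifold3 R) (H : CR_structure M)
  (theta : form1 M) (htheta : pseudohermitian H theta)
  (hpos : levi_pos_def H theta)
  (T : vfield M) (hT : reeb_field theta T)
  (g : metric_tensor M) (hg : webster_metric H theta T g)
  (n : nat) (f : M -> 'rV[R]_n) (himm : immersion f) (hiso : isometric g f) :
  (pluriharmonic_map H f -> garfield_lee_isotropic H theta T f) /\
  (garfield_lee_isotropic H theta T f ->
   rumin_normal_constant_length H theta T f).
Proof.
split=> [hf U Z zeta hZ p Up|isot].
  exact (pluriharmonic_isotropic htheta hT hZ hg hiso himm Up hf).
have rum U Z zeta (hZ : pseudohermitian_frame H theta T U Z zeta) p (Up : U p) :=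
  isotropic_rumin htheta hT hZ hg hiso himm Up (isot U Z zeta hZ p Up).
split=> [U Z zeta hZ p Up|]; first by have [] := rum U Z zeta hZ p Up.
by exists 1 => U Z zeta hZ p Up; have [] := rum U Z zeta hZ p Up.
Qed.
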